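(* For all positive integers $n,m$, the minimum number of colors needed to color the vertices of the oriented graph $\vec{K}^{(m)}_n$ such that there is no monochromatic directed triangle is greater than or equal to $\dfrac{nm}{n+2m-2}$.
   Context: $K^{(m)}_n$ denotes the complete balanced $n$-partite graph in which each part has exactly $m$ vertices. The oriented graph $\vec{K}^{(m)}_n$ is the following orientation of it. Its vertices are the $nm$ pairs (cells) $(i,j)$ of integers with $1\leq i\leq n$, $1\leq j\leq m$. The parts are the rows $\{(i,j):1\leq j\leq m\}$, $1\leq i\leq n$; thus there is no edge between two vertices with the same first coordinate, and exactly one directed edge between any two vertices with different first coordinates. The vertices are totally ordered by: $(i_1,j_1)<(i_2,j_2)$ iff either $i_1<i_2$, or $i_1=i_2$ and $j_1<j_2$. For two vertices $(i_1,j_1),(i_2,j_2)$ with $i_1\neq i_2$: if $j_1=j_2$, the edge is directed from $(i_1,j_1)$ to $(i_2,j_2)$ iff $(i_1,j_1)<(i_2,j_2)$; if $j_1\neq j_2$, the edge is directed from $(i_1,j_1)$ to $(i_2,j_2)$ iff $(i_1,j_1)>(i_2,j_2)$. *)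

(* Defs.v *)
From mathcomp Require Import all_boot all_order all_algebra.

Set Implicit Arguments.
Unset Strict Implicit.
Unset Printing Implicit Defensive.

Section TriangleFreeColoring.
Variables (T : finType) (e : rel T).

Definition directed_triangle (x y z : T) : bool :=
  [&& uniq [:: x; y; z], e x y, e y z & e z x].

Definition no_mono_triangle (k : nat) (c : {ffun T -> 'I_k}) : bool :=
  [forall x, forall y, forall z,
     directed_triangle x y z ==> ~~ ((c x == c y) && (c y == c z))].

Definition triangle_colorable (k : nat) : bool :=
  [exists c : {ffun T -> 'I_k}, no_mono_triangle c].

Lemma triangle_colorable_ex : exists k, triangle_colorable k.
Proof.
exists #|T|; apply/existsP; exists [ffun x => enum_rank x].
apply/forallP=> x; apply/forallP=> y; apply/forallP=> z; apply/implyP.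
case/andP=> /= /and3P[xNyz _ _] _; rewrite !ffunE !(inj_eq enum_rank_inj).
by apply: contra xNyz => /andP[/eqP-> _]; rewrite !inE eqxx.
Qed.

Definition min_triangle_colors : nat := ex_minn triangle_colorable_ex.

End TriangleFreeColoring.

(* Rows and columns are numbered from 0; only their relative order matters. *)
Definition cell (n m : nat) : finType := ('I_n * 'I_m)%type.

Definition cell_lt (n m : nat) : rel (cell n m) :=
  fun u v => (u.1 < v.1) || ((u.1 == v.1) && (u.2 < v.2)).

Definition K_arc (n m : nat) : rel (cell n m) :=
  fun u v => (u.1 != v.1) &&
    (if u.2 == v.2 then cell_lt u v else cell_lt v u).

Lemma K_arc_orientation (n m : nat) (u v : cell n m) :
  K_arc u v (+) K_arc v u = (u.1 != v.1).
Proof.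
rewrite /K_arc /cell_lt ![v.1 == _]eq_sym [v.2 == _]eq_sym -(inj_eq val_inj) /=.
by case: ltngtP => //= _; case: (u.2 == v.2).
Qed.

(* Main.v *)
Require Import Defs.
From mathcomp Require Import all_boot all_order all_algebra.
From mathcomp Require Import zify.

Import Order.TTheory GRing.Theory Num.Theory.
Local Open Scope ring_scope.

(** A set of cells without directed triangle has at most [n + 2m - 2] elements,
    so [k] colours can only cover the [nm] cells if [nm <= k (n + 2m - 2)].

    The size bound comes from one family of triangles: two cells of a column
    [a], together with a cell of another column in a row strictly between
    theirs, form a directed triangle ([K_arc_triangle]).  Hence, in a
    triangle-free set [S], a row lying strictly between two cells of [S] in
    column [a] contains no cell of [S] outside that column.  Split [S] into the
    cells that are topmost or bottommost in their column, at most [2m] of them,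
    and the remaining inner cells.  By the above, inner cells lie in pairwise
    distinct rows, and none of them lies in the first or the last row, so there
    are at most [n - 2] of them when [n >= 2] ([triangle_free_card]).  When
    [n = 1], each column has at most one cell, and [m <= 2m - 1]. *)

Lemma K_arc_triangle {n m : nat} (i1 i2 i3 : 'I_n) (a b : 'I_m) :
  (i1 < i2)%N -> (i2 < i3)%N -> b != a ->
  directed_triangle (@K_arc n m) (i1, a) (i3, a) (i2, b).
Proof.
move=> lt12 lt23 bNa; have lt13 := ltn_trans lt12 lt23.
have neqs : [/\ i1 != i2, i1 != i3 & i3 != i2].
  by rewrite -!val_eqE /= (ltn_eqF lt12) (ltn_eqF lt13) (gtn_eqF lt23).
case: neqs => n12 n13 n32.
rewrite /directed_triangle /K_arc /cell_lt /= !inE !xpair_eqE.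
rewrite (negbTE n12) (negbTE n13) (negbTE n32) eqxx (eq_sym a b) (negbTE bNa).
by rewrite lt12 lt23 lt13 (eq_sym i2 i1) (negbTE n12).
Qed.

Definition triangle_free {T : finType} (e : rel T) (S : {set T}) : Prop :=
  forall x y z, x \in S -> y \in S -> z \in S -> ~~ directed_triangle e x y z.

Section TriangleFreeSets.
Variables (n m : nat) (S : {set cell n m}).

Definition has_above (u : cell n m) : bool :=
  [exists v in S, (v.2 == u.2) && (v.1 < u.1)%N].

Definition has_below (u : cell n m) : bool :=
  [exists v in S, (v.2 == u.2) && (u.1 < v.1)%N].

Definition top_cells : {set cell n m} := [set u in S | ~~ has_above u].
Definition bottom_cells : {set cell n m} := [set u in S | ~~ has_below u].
Definition inner_cells : {set cell n m} :=
  [set u in S | has_above u && has_below u].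

Lemma card_top_cells : (#|top_cells| <= m)%N.
Proof.
have inj2 : {in top_cells &, injective (fun u : cell n m => u.2)}.
  move=> [i a] [j b]; rewrite !inE => /andP[Su topu] /andP[Sv topv] /= eab.
  move: eab Sv topv => <- Sv topv.
  case: (ltngtP i j) => [ltij|ltji|/val_inj -> //].
    by case/existsP: topv; exists (i, a); rewrite Su eqxx.
  by case/existsP: topu; exists (j, a); rewrite Sv eqxx.
by rewrite -(card_in_imset inj2) -[leqRHS]card_ord max_card.
Qed.

Lemma card_bottom_cells : (#|bottom_cells| <= m)%N.
Proof.
have inj2 : {in bottom_cells &, injective (fun u : cell n m => u.2)}.
  move=> [i a] [j b]; rewrite !inE => /andP[Su botu] /andP[Sv botv] /= eab.
  move: eab Sv botv => <- Sv botv.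
  case: (ltngtP i j) => [ltij|ltji|/val_inj -> //].
    by case/existsP: botu; exists (j, a); rewrite Sv eqxx.
  by case/existsP: botv; exists (i, a); rewrite Su eqxx.
by rewrite -(card_in_imset inj2) -[leqRHS]card_ord max_card.
Qed.

(** If two inner cells shared a row, the second would lie between the witnesses
    above and below the first, closing a triangle with them. *)
Lemma inner_cells_row_inj :
  triangle_free (@K_arc n m) S ->
  {in inner_cells &, injective (fun u : cell n m => u.1)}.
Proof.
move=> freeS [i a] [j b]; rewrite !inE => /andP[_ /andP[above below]].
case/andP=> Sv _ /= eij; move: Sv; rewrite -{}eij => Sv.
case/existsP: above => -[i1 a1] /= /and3P[Su1 /eqP ea1 lt1].
case/existsP: below => -[i3 a3] /= /and3P[Su3 /eqP ea3 lt3].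
rewrite {}ea1 in Su1; rewrite {}ea3 in Su3.
case: (eqVneq b a) => [-> // | bNa].
by have := freeS _ _ _ Su1 Su3 Sv; rewrite K_arc_triangle.
Qed.

(** The [n - 2] available rows are those other than the first and the last;
    for [n = 1] the truncated subtraction still gives the right count, 0. *)
Lemma card_inner_cells :
  triangle_free (@K_arc n m) S -> (#|inner_cells| <= n - 2)%N.
Proof.
move=> freeS; rewrite -(card_in_imset (inner_cells_row_inj freeS)).
set rows := imset _ _.
have rowsP (i : 'I_n) : i \in rows -> (0 < i)%N /\ (i.+1 < n)%N.
  case/imsetP=> u; rewrite inE => /and3P[_ /existsP[v above] /existsP[w below]].
  move=> ->; case/and3P: above => _ _ ltv; case/and3P: below => _ _ ltw.
  by split; [apply: leq_trans ltv | apply: leq_ltn_trans ltw (ltn_ord _)].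
case: n rows rowsP => [|[|p]] rows rowsP.
- by rewrite -[leqRHS](card_ord 0) max_card.
- by rewrite leqn0 cards_eq0 -subset0; apply/subsetP=> i /rowsP[].
have sub_rows : rows \subset ~: [set ord0; ord_max].
  apply/subsetP=> i /rowsP[i_gt0 i_lt]; rewrite !inE -!val_eqE /=.
  by apply/norP; lia.
apply: leq_trans (subset_leq_card sub_rows) _.
by rewrite cardsCs setCK card_ord cards2.
Qed.

Lemma triangle_free_card :
  (0 < n)%N -> (0 < m)%N -> triangle_free (@K_arc n m) S ->
  (#|S| <= n + 2 * m - 2)%N.
Proof.
move=> n_gt0 m_gt0 freeS.
have [n_le1 | n_gt1] := leqP n 1.
  have top_all : S \subset top_cells.
    apply/subsetP=> u Su; rewrite inE Su; apply/existsP=> -[v].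
    case/and3P=> _ _ ltvu; have := leq_trans (ltn_ord u.1) n_le1.
    by rewrite ltnS leqNgt (leq_ltn_trans _ ltvu).
  have := leq_trans (subset_leq_card top_all) card_top_cells; lia.
have cover : S \subset top_cells :|: bottom_cells :|: inner_cells.
  by apply/subsetP=> u Su; rewrite !inE Su; case: has_above; case: has_below.
have outer_le : (#|top_cells :|: bottom_cells| <= m + m)%N.
  apply: leq_trans (leq_card_setU _ _).1 _.
  exact: leq_add card_top_cells card_bottom_cells.
have -> : (n + 2 * m - 2 = (m + m) + (n - 2))%N by lia.
apply: leq_trans (subset_leq_card cover) _.
apply: leq_trans (leq_card_setU _ _).1 _.
exact: leq_add outer_le (card_inner_cells freeS).
Qed.

End TriangleFreeSets.

Lemma colour_class_triangle_free {T : finType} (e : rel T) (k : nat)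
    (c : {ffun T -> 'I_k}) (i : 'I_k) :
  no_mono_triangle e c -> triangle_free e [set u | c u == i].
Proof.
move=> mono x y z; rewrite !inE => /eqP cx /eqP cy /eqP cz.
apply/negP=> tri; move/forallP/(_ x)/forallP/(_ y)/forallP/(_ z): mono.
by rewrite tri cx cy cz eqxx.
Qed.

Lemma colouring_card {T : finType} (k b : nat) (c : {ffun T -> 'I_k}) :
  (forall i, #|[set u | c u == i]| <= b)%N -> (#|T| <= k * b)%N.
Proof.
move=> classes; rewrite -sum1_card (partition_big c xpredT) //=.
rewrite -[k in leqRHS]card_ord -sum_nat_const; apply: leq_sum => i _.
by apply: leq_trans (classes i); rewrite sum1dep_card.
Qed.

Theorem theorem2p11 (n m : nat) (hn : (0 < n)%N) (hm : (0 < m)%N) :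
  n%:R * m%:R / (n%:R + 2 * m%:R - 2) <=
    (min_triangle_colors (@K_arc n m))%:R :> rat.
Proof.
rewrite /min_triangle_colors; case: ex_minnP => k /existsP[c mono] _.
have cells_le : (n * m <= k * (n + 2 * m - 2))%N.
  rewrite -[n in leqLHS]card_ord -[m in leqLHS]card_ord -card_prod.
  apply: (colouring_card k _ c) => i.
  by apply: triangle_free_card (colour_class_triangle_free _ _ c i mono).
have denomE : n%:R + 2 * m%:R - 2 = (n + 2 * m - 2)%N%:R :> rat.
  have two_le : (2 <= n + 2 * m)%N by lia.
  by rewrite natrB // natrD natrM.
rewrite denomE ler_pdivrMr; last by rewrite ltr0n; lia.
by rewrite -!natrM ler_nat.
Qed.
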